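(* Let $a,b\in\mathbb{R}^n$. Then (i) $\operatorname{tconv}\operatorname{conv}(a,b)=\operatorname{conv}\operatorname{tconv}(a,b)$; (ii) $\operatorname{tconv}\operatorname{pos}(a)=\operatorname{pos}\operatorname{tconv}(0,a)$.
   Context: Tropical semiring $(\mathbb{R},\oplus,\odot)$ with $x\oplus y=\min(x,y)$ and $x\odot y=x+y$. For $c\in\mathbb{R}$ and $x\in\mathbb{R}^n$, $c\odot x=(c+x_1,\dots,c+x_n)$, and $\oplus$ of vectors is the coordinatewise minimum. A set $U\subseteq\mathbb{R}^n$ is tropically convex if $(c\odot x)\oplus(d\odot y)\in U$ for all $x,y\in U$ and all $c,d\in\mathbb{R}$ with $\min(c,d)=0$. The tropical convex hull $\operatorname{tconv}U$ is the smallest tropically convex set containing $U$. For a finite set $V=\{v_1,\dots,v_k\}$ it equals $\{c_1\odot v_1\oplus\cdots\oplus c_k\odot v_k : c_i\in\mathbb{R},\ \min_i c_i=0\}$, and in general $\operatorname{tconv}U$ is the union of $\operatorname{tconv}V$ over all finite $V\subseteq U$. $\operatorname{conv}$ denotes the ordinary convex hull, $\operatorname{conv}(a,b)$ the ordinary segment, and $\operatorname{tconv}(a,b)=\operatorname{tconv}\{a,b\}$. For a point $a$, $\operatorname{pos}(a)=\{\lambda a:\lambda\ge 0\}$, and for a set $S$, $\operatorname{pos}S$ is the set of nonnegative linear combinations of its elements. *)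

(* Defs.v *)
From HB Require Import structures.
From mathcomp Require Import all_boot all_order all_algebra.
From mathcomp Require Import interval_inference.
From mathcomp Require Import mathcomp_extra boolp classical_sets reals convex.

Set Implicit Arguments.
Unset Strict Implicit.
Unset Printing Implicit Defensive.

Import Order.TTheory GRing.Theory Num.Theory.

Local Open Scope classical_set_scope.
Local Open Scope ring_scope.
Local Open Scope convex_scope.

Definition tscale (R : realType) (n : nat) (c : R) (x : 'rV[R]_n) : 'rV[R]_n :=
  \row_i (c + x 0 i).

Definition tadd (R : realType) (n : nat) (x y : 'rV[R]_n) : 'rV[R]_n :=
  \row_i Num.min (x 0 i) (y 0 i).

Definition tropically_convex (R : realType) (n : nat) (U : set 'rV[R]_n) :=
  forall (x y : 'rV[R]_n) (c d : R), U x -> U y -> Num.min c d = 0 ->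
    U (tadd (tscale c x) (tscale d y)).

Definition tconv (R : realType) (n : nat) (U : set 'rV[R]_n) : set 'rV[R]_n :=
  smallest (@tropically_convex R n) U.

Definition convex_hull (R : realType) (n : nat) (U : set 'rV[R]_n) :
  set 'rV[R]_n := smallest (@convex_set R 'rV[R]_n) U.

Definition segment (R : realType) (n : nat) (a b : 'rV[R]_n) : set 'rV[R]_n :=
  [set x | exists t : R, 0 <= t <= 1 /\ x = t *: a + (1 - t) *: b].

Definition ray (R : realType) (n : nat) (a : 'rV[R]_n) : set 'rV[R]_n :=
  [set x | exists l : R, 0 <= l /\ x = l *: a].

(* The empty combination (k = 0) is allowed, so 0 belongs to pos S. *)
Definition pos (R : realType) (n : nat) (S : set 'rV[R]_n) : set 'rV[R]_n :=
  [set x | exists (k : nat) (l : 'I_k -> R) (v : 'I_k -> 'rV[R]_n),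
     [/\ forall i, 0 <= l i, forall i, S (v i) & x = \sum_i l i *: v i]].

Lemma convex_hull2 (R : realType) (n : nat) (a b : 'rV[R]_n) :
  convex_hull [set a; b] = segment a b.
Proof.
apply/seteqP; split => [x hx|x [t [/andP[t0 t1] ->]]].
  apply: (hx (segment a b)); split=> [|y [->|->]].
  - move=> u v p; rewrite !inE => -[s [/andP[s0 s1] ->]] [t [/andP[t0 t1] ->]].
    have p0 : 0 <= p%:num by [].
    have p1 : 0 <= 1 - p%:num by rewrite subr_ge0.
    exists (p%:num * s + (1 - p%:num) * t); split.
      rewrite addr_ge0 ?mulr_ge0 //=.
      rewrite -[leRHS](subrKC p%:num 1) lerD//.
        by rewrite ler_piMr.
      by rewrite ler_piMr.
    change (p%:num *: (s *: a + (1 - s) *: b) +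
      (1 - p%:num) *: (t *: a + (1 - t) *: b) =
      (p%:num * s + (1 - p%:num) * t) *: a +
      (1 - (p%:num * s + (1 - p%:num) * t)) *: b).
    rewrite !scalerDr !scalerA addrACA -!scalerDl.
    congr (_ + _ *: b); rewrite !mulrBr !mulr1 opprD addrACA.
    by congr (_ + _); rewrite subrKC.
  - by exists 1; rewrite ler01 lexx subrr scale1r scale0r addr0.
  - by exists 0; rewrite ler01 lexx subr0 scale1r scale0r add0r.
move=> B [cB sB].
have ht : Itv.spec (@Itv.num_sem R) (Itv.Real `[0%Z, 1%Z]) t.
  by rewrite /= /Itv.num_sem /= ger0_real //= in_itv /= t0.
have := cB a b (Itv.mk ht); rewrite !inE; apply.
- by apply: sB; left.
- by apply: sB; right.
Qed.

Lemma pos1 (R : realType) (n : nat) (a : 'rV[R]_n) : pos [set a] = ray a.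
Proof.
apply/seteqP; split => [x [k [l [v [l0 va ->]]]]|x [l [l0 ->]]].
  exists (\sum_i l i); split; first exact: sumr_ge0.
  by rewrite scaler_suml; apply: eq_bigr => i _; rewrite va.
by exists 1%N, (fun=> l), (fun=> a); rewrite big_ord1.
Qed.

(* Main.v *)
Require Import Defs.
From mathcomp Require Import all_boot all_order all_algebra.
From mathcomp Require Import classical_sets reals.
From mathcomp Require Import interval_inference convex lra ring.

Set Implicit Arguments.
Unset Strict Implicit.

Import Order.TTheory GRing.Theory Num.Theory.

Local Open Scope classical_set_scope.
Local Open Scope ring_scope.

(** Write [u = a - b].  All the sets involved consist of points [b + f(u)], with
    [f] applied coordinatewise, where [f] is concave with [f 0 = 0] and slopes
    in [[0, 1]] for part (i), respectively in [[0, +oo[] for part (ii).  This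
    class of functions is stable under both kinds of convex combinations.
    Conversely, on the finitely many coordinates of [u], such an [f] is the
    minimum of its supporting lines, which gives a tropical combination of
    points of the segment (or ray); and it is a combination of the functions
    [min t s - min 0 s], which parametrize the tropical segment. *)

(* Concavity is expressed by a choice [g] of supergradients, so that no
   completeness argument is needed to obtain supporting lines. *)
Definition concave_profile (R : realType) (L : R) (f : R -> R) :=
  f 0 = 0 /\ exists g : R -> R,
    forall s, 0 <= g s <= L /\ forall t, f t <= f s + g s * (t - s).

Definition profile_point (R : realType) (n : nat) (b u : 'rV[R]_n)
  (f : R -> R) : 'rV[R]_n := \row_i (b 0 i + f (u 0 i)).

Definition profile_set (R : realType) (n : nat) (L : R) (b u : 'rV[R]_n) :
  set 'rV[R]_n :=
  [set x | exists2 f, concave_profile L f & x = profile_point b u f].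

(** Slope 1 up to the breakpoint [s] and 0 beyond; the constant makes it vanish at 0. *)
Definition truncation (R : realType) (s t : R) : R := Num.min t s - Num.min 0 s.

(** * Closure properties of concave profiles *)

Lemma concave_profile_linear (R : realType) (L l : R) :
  0 <= l <= L -> concave_profile L (fun t => l * t).
Proof.
move=> hl; split; first by rewrite mulr0.
by exists (fun=> l) => s; split=> // t; lra.
Qed.

Lemma concave_profileW (R : realType) (L M : R) (f : R -> R) :
  L <= M -> concave_profile L f -> concave_profile M f.
Proof.
move=> LM [f0 [g hg]]; split=> //; exists g => s.
have [/andP[g0 gL] h] := hg s; split=> //.
by rewrite g0 (le_trans gL).
Qed.

(** Supergradients combine linearly, so the bound takes up the weights; this serves convex
    combinations and sums in a cone alike. *)
Lemma concave_profile_comb (R : realType) (L M p q : R) (f h : R -> R) :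
  0 <= p -> 0 <= q -> concave_profile L f -> concave_profile M h ->
  concave_profile (p * L + q * M) (fun t => p * f t + q * h t).
Proof.
move=> p0 q0 [f0 [g hg]] [h0 [k hk]]; split.
  by rewrite f0 h0 !mulr0 addr0.
exists (fun s => p * g s + q * k s) => s.
have [/andP[g0 gL] hf] := hg s; have [/andP[k0 kM] hh] := hk s.
split; first by rewrite addr_ge0 ?mulr_ge0//= lerD ?ler_wpM2l.
move=> t; have := lerD (ler_wpM2l p0 (hf t)) (ler_wpM2l q0 (hh t)).
by move/le_trans; apply; lra.
Qed.

(** At each point, the function attaining the minimum supplies the supergradient. *)
Lemma concave_profile_min (R : realType) (L c d : R) (f h : R -> R) :
  Num.min c d = 0 -> concave_profile L f -> concave_profile L h ->
  concave_profile L (fun t => Num.min (c + f t) (d + h t)).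
Proof.
move=> cd [f0 [g hg]] [h0 [k hk]]; split; first by rewrite f0 h0 !addr0.
exists (fun s => if c + f s <= d + h s then g s else k s) => s.
have [gL hf] := hg s; have [kL hh] := hk s.
case: (leP (c + f s) (d + h s)) => _; split=> // t;
  rewrite ge_min; apply/orP; [left|right].
  by have := hf t; lra.
by have := hh t; lra.
Qed.

(** * Profile sets and tropical convexity *)

Lemma profile_set_linear (R : realType) (n : nat) (L l : R) (b u : 'rV[R]_n) :
  0 <= l <= L -> profile_set L b u (b + l *: u).
Proof.
move=> hl; exists (fun t => l * t); first exact: concave_profile_linear.
by apply/rowP => i; rewrite !mxE.
Qed.

Lemma profile_set_tropical (R : realType) (n : nat) (L : R) (b u : 'rV[R]_n) :
  tropically_convex (profile_set L b u).
Proof.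
move=> _ _ c d [f hf ->] [h hh ->] cd.
exists (fun t => Num.min (c + f t) (d + h t)); first exact: concave_profile_min.
apply/rowP => i; rewrite !mxE addr_minr.
by congr (Num.min _ _); lra.
Qed.

(** Starting from [z], which dominates [x], each coordinate in turn is lowered to that of [x] by a
    tropical sum with a translate touching [x] there. As [0 <= c], the coefficients [0] and [c] have
    minimum 0. *)
Lemma tropical_envelope (R : realType) (n : nat) (V : set 'rV[R]_n)
  (x z : 'rV[R]_n) :
  tropically_convex V -> V z -> (forall i, x 0 i <= z 0 i) ->
  (forall j, exists y, exists2 c, 0 <= c &
     [/\ V y, forall i, x 0 i <= c + y 0 i & c + y 0 j <= x 0 j]) ->
  V x.
Proof.
move=> tV Vz xz hV.
have [w [Vw xw wx]] : exists w, [/\ V w, forall i, x 0 i <= w 0 i &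
    forall j, j \in enum 'I_n -> w 0 j <= x 0 j].
  elim: (enum 'I_n) => [|j r [w [Vw xw wx]]]; first by exists z.
  have [y [c c0 [Vy xy yx]]] := hV j.
  exists (tadd (tscale 0 w) (tscale c y)); split.
  - by apply: tV => //; rewrite min_l.
  - by move=> i; rewrite !mxE add0r le_min xw xy.
  - move=> i; rewrite inE !mxE add0r ge_min => /orP[/eqP->|/wx ->//].
    by rewrite yx orbT.
suff -> : x = w by [].
by apply/rowP => i; apply/eqP; rewrite eq_le xw wx ?mem_enum.
Qed.

Lemma profile_set_sub_tropical (R : realType) (n : nat) (V : set 'rV[R]_n)
  (L : R) (b u : 'rV[R]_n) :
  tropically_convex V -> (forall l, 0 <= l <= L -> V (b + l *: u)) ->
  profile_set L b u `<=` V.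
Proof.
move=> tV lV _ [f [f0 [g hg]] ->].
have [g0 hf] := hg 0.
(* The supporting line at 0 has intercept [f 0 = 0], so it gives the initial dominating point. *)
apply: (@tropical_envelope _ _ _ _ (b + g 0 *: u)) => //; first exact: lV.
  by move=> i; rewrite !mxE; have := hf (u 0 i); lra.
move=> j; have [gj hj] := hg (u 0 j).
(* Slope and intercept of the supporting line at [u 0 j]; the intercept is nonnegative because the
   line lies above [f] at 0. *)
exists (b + g (u 0 j) *: u), (f (u 0 j) - g (u 0 j) * u 0 j).
  by have := hj 0; lra.
split; [exact: lV| |by rewrite !mxE; lra].
by move=> i; rewrite !mxE; have := hj (u 0 i); lra.
Qed.

(** * Ordinary convexity and points of the tropical segment *)

Lemma convex_setE (R : realType) (n : nat) (B : set 'rV[R]_n) :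
  convex_set B <-> forall x y t, 0 <= t <= 1 -> B x -> B y ->
    B (t *: x + (1 - t) *: y).
Proof.
split=> [cB x y t /andP[t0 t1] Bx By|cB x y p].
  have ht : Itv.spec (@Itv.num_sem R) (Itv.Real `[0%Z, 1%Z]) t.
    by rewrite /= /Itv.num_sem /= ger0_real //= in_itv /= t0.
  by have := cB x y (Itv.mk ht); rewrite !inE; apply.
rewrite !inE => Bx By; apply: (cB x y p%:num) => //.
by apply/andP; split.
Qed.

Lemma profile_set_convex (R : realType) (n : nat) (b u : 'rV[R]_n) :
  convex_set (profile_set 1 b u).
Proof.
apply/convex_setE => _ _ t t01 [f hf ->] [h hh ->].
exists (fun s => t * f s + (1 - t) * h s).
  rewrite [X in concave_profile X](_ : 1 = t * 1 + (1 - t) * 1); last by ring.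
  by apply: concave_profile_comb => //; lra.
by apply/rowP => i; rewrite !mxE; lra.
Qed.

Lemma tconv_truncation (R : realType) (n : nat) (a b : 'rV[R]_n) (s : R) :
  tconv [set a; b] (profile_point b (a - b) (truncation s)).
Proof.
move=> B [tB sB].
(* The breakpoint is the difference of the two tropical coefficients; subtracting [Num.min 0 s]
   normalises their minimum to 0. *)
have -> : profile_point b (a - b) (truncation s) =
    tadd (tscale (- Num.min 0 s) a) (tscale (s - Num.min 0 s) b).
  apply/rowP => i; rewrite !mxE /truncation.
  by rewrite addrA addr_minr addr_minl; congr (Num.min _ _); ring.
apply: tB; [exact: sB (or_introl erefl)|exact: sB (or_intror erefl)|].
by rewrite -[X in Num.min X _]add0r -addr_minl subrr.
Qed.

(** The weight is [p / (p + q)]; the division-free equation also covers [p + q = 0], where any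
    weight will do. *)
Lemma convex_cone_comb (R : realType) (n : nat) (B : set 'rV[R]_n)
  (x y : 'rV[R]_n) (p q : R) :
  convex_set B -> 0 <= p -> 0 <= q -> B x -> B y ->
  exists2 t, (p + q) * t = p & B (t *: x + (1 - t) *: y).
Proof.
move=> /convex_setE cB p0 q0 Bx By.
have [pq0|pq0] := eqVneq (p + q) 0.
  have p00 : p = 0 by lra.
  by exists 0; [rewrite mulr0 p00|apply: cB => //; rewrite lexx ler01].
have pq : 0 < p + q by rewrite lt_def pq0 addr_ge0.
have t01 : 0 <= p / (p + q) <= 1.
  by rewrite divr_ge0 ?(ltW pq)//= ler_pdivrMr// mul1r lerDl.
by exists (p / (p + q)); [rewrite mulrC divfK|apply: cB].
Qed.

(** * Interpolation of concave functions by truncations *)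

Lemma chord_slope (R : realType) (f g : R -> R) (s t : R) :
  (forall x y, f y <= f x + g x * (y - x)) -> s <= t ->
  exists2 m, g t <= m <= g s & f t - f s = m * (t - s).
Proof.
move=> hf; rewrite le_eqVlt => /orP[/eqP->|st].
  by exists (g t); rewrite ?lexx// !subrr mulr0.
have ts : 0 < t - s by rewrite subr_gt0.
exists ((f t - f s) / (t - s)); last by rewrite divfK ?gt_eqF.
rewrite ler_pdivlMr// ler_pdivrMr//; apply/andP; split.
  by have := hf t s; lra.
by have := hf s t; lra.
Qed.

Lemma truncation_le (R : realType) (s t : R) :
  t <= s -> truncation s t = t - Num.min 0 s.
Proof. by rewrite /truncation => /min_l ->. Qed.

Lemma truncation_ge (R : realType) (s t : R) :
  s <= t -> truncation s t = s - Num.min 0 s.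
Proof. by rewrite /truncation => /min_r ->. Qed.

Section Interpolation.
(** [G] abstracts the profiles whose points lie in the convex hull of the tropical segment. *)
Variables (R : realType) (G : (R -> R) -> Prop).
Hypothesis Gtrunc : forall s, G (truncation s).
Hypothesis Gcomb : forall h k p q, 0 <= p -> 0 <= q -> G h -> G k ->
  exists2 e, G e & forall t, (p + q) * e t = p * h t + q * k t.

(* The chord slopes decrease along the list; each decrease is the weight of a
   truncation.  The last clause is the linearity of [k] below [s], multiplied
   by [g s] because nothing is known about [k] when [g s = 0]. *)
Lemma interpolation_path (f g : R -> R) (s : R) (r : seq R) :
  (forall x y, f y <= f x + g x * (y - x)) -> (forall x, 0 <= g x) ->
  path <=%O s r ->
  exists2 k, G k &
    (forall t, t \in s :: r -> f t - f s = g s * (k t - k s)) /\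
    (forall t, t <= s -> g s * (k t - k s) = g s * (t - s)).
Proof.
move=> hf g0; elim: r s => [|s1 r IH] s /=.
  move=> _; exists (truncation s) => //; split=> t.
    by rewrite inE => /eqP->; rewrite !subrr mulr0.
  by move=> ts; rewrite !truncation_le//; ring.
move=> /andP[ss1 pr]; have [k Gk [kr kl]] := IH _ pr.
have [m /andP[gm mg] fm] := chord_slope hf ss1.
(* The slope drops from [g s] to [m] at [s] and from [m] to [g s1] at [s1]. Together with the weight
   [g s1] of [k], these drops sum to [g s]. *)
have m1 : 0 <= m - g s1 by lra.
have m2 : 0 <= g s - m by lra.
have [e Ge he] := Gcomb m1 m2 (Gtrunc s1) (Gtrunc s).
have m3 : 0 <= m - g s1 + (g s - m) by lra.
have [d Gd hd] := Gcomb (g0 s1) m3 Gk Ge.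
have {}hd t : g s * d t =
    g s1 * k t + (m - g s1) * truncation s1 t + (g s - m) * truncation s t.
  by rewrite -addrA -he -hd; ring.
exists d => //; split=> t.
  rewrite inE => /orP[/eqP->|ts]; first by rewrite !subrr mulr0.
  have s1t : s1 <= t.
    move: ts; rewrite inE => /orP[/eqP->//|tr].
    by have /allP/(_ _ tr) := order_path_min le_trans pr.
  rewrite mulrBr !hd (truncation_ge s1t) (truncation_le ss1).
  rewrite (truncation_ge (le_trans ss1 s1t)) (truncation_le (lexx s)).
  by have := kr t ts; have := kl s ss1; lra.
move=> ts; rewrite mulrBr !hd (truncation_le ss1) (truncation_le ts).
rewrite (truncation_le (lexx s)) (truncation_le (le_trans ts ss1)).
by have := kl s ss1; have := kl t (le_trans ts ss1); lra.
Qed.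

Lemma interpolation (L : R) (f : R -> R) (r : seq R) :
  (forall k, G k -> k 0 = 0) -> concave_profile L f ->
  exists2 k, G k & forall t, t \in r -> f t = L * k t.
Proof.
move=> G0 [f0 [g hg]].
have hf x y : f y <= f x + g x * (y - x) by have [_] := hg x; apply.
have g0 x : 0 <= g x by have [/andP[]] := hg x.
(* Including 0 fixes the additive constant: both functions vanish there, so equal increments give
   equal values. *)
have := sort_le_sorted (0 :: r); have := mem_sort <=%O (0 :: r).
case: (sort _ _) => [|s l] /= hmem hsort.
  by have := hmem 0; rewrite mem_head.
have [k Gk [kr _]] := interpolation_path hf g0 hsort.
(* The remaining weight goes to the truncation at the least point [s], which is constant on the
   list. *)
have Lg : 0 <= L - g s by have [/andP[_ gL] _] := hg s; lra.
have [d Gd hd] := Gcomb (g0 s) Lg Gk (Gtrunc s).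
have {}hd t : L * d t = g s * k t + (L - g s) * truncation s t.
  by rewrite -hd; ring.
have sle t : t \in s :: l -> s <= t.
  rewrite inE => /orP[/eqP->//|tl].
  by have /allP/(_ _ tl) := order_path_min le_trans hsort.
have in0 : 0 \in s :: l by rewrite hmem mem_head.
exists d => // t tr.
have int : t \in s :: l by rewrite hmem inE tr orbT.
have := hd 0; rewrite (G0 _ Gd) mulr0 (truncation_ge (sle _ in0)) => hd0.
rewrite hd (truncation_ge (sle _ int)).
by have := kr _ in0; have := kr _ int; rewrite f0; lra.
Qed.

End Interpolation.

(** Dividing slopes by [L] is a homothety about [b]. Part (i) uses [L = 1], part (ii) uses every [L]
    with base point 0. *)
Lemma profile_set_hull (R : realType) (n : nat) (L : R) (a b : 'rV[R]_n) :
  profile_set L b (a - b) `<=`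
  [set b + L *: (y - b) | y in convex_hull (tconv [set a; b])].
Proof.
move=> _ [f hf ->].
set u := a - b.
pose B := convex_hull (tconv [set a; b]).
have cB : convex_set B.
  apply/convex_setE => x y t t01 Bx By C [cC sC].
  by have /convex_setE := cC; apply=> //; [apply: Bx|apply: By].
pose G k := k 0 = 0 /\ B (profile_point b u k).
have [|||k [_ Bk] hk] := @interpolation R G _ _ L f [seq u 0 i | i : 'I_n] _ hf.
- move=> s; split; first by rewrite /truncation subrr.
  by move=> C [_]; apply; apply: tconv_truncation.
- move=> h k p q p0 q0 [h0 Bh] [k0 Bk].
  have [t pqt Bt] := convex_cone_comb cB p0 q0 Bh Bk.
  exists (fun x => t * h x + (1 - t) * k x).
    split; first by rewrite h0 k0 !mulr0 addr0.
    by move: Bt; congr B; apply/rowP => i; rewrite !mxE; ring.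
  by move=> x; rewrite mulrDr !mulrA pqt; congr (_ + _ * _); lra.
- by move=> k [].
exists (profile_point b u k) => //.
apply/rowP => i; rewrite !mxE addrAC subrr add0r hk ?mxE//.
by apply/mapP; exists i; rewrite ?mem_enum ?mxE.
Qed.

(** * Nonnegative cones and hulls *)

Lemma pos_scale (R : realType) (n : nat) (S : set 'rV[R]_n) (x : 'rV[R]_n)
  (l : R) : 0 <= l -> pos S x -> pos S (l *: x).
Proof.
move=> l0 [k [c [v [c0 Sv ->]]]].
exists k, (fun i => l * c i), v; split=> // [i|]; first exact: mulr_ge0.
by rewrite scaler_sumr; apply: eq_bigr => i _; rewrite scalerA.
Qed.

Lemma pos_add (R : realType) (n : nat) (S : set 'rV[R]_n) (x y : 'rV[R]_n) :
  pos S x -> pos S y -> pos S (x + y).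
Proof.
move=> [k [c [v [c0 Sv ->]]]] [m [d [w [d0 Sw ->]]]].
exists (k + m)%N,
  (fun i => match fintype.split i with inl j => c j | inr j => d j end),
  (fun i => match fintype.split i with inl j => v j | inr j => w j end); split.
- by move=> i; case: fintype.split.
- by move=> i; case: fintype.split.
- rewrite big_split_ord/=; congr (_ + _); apply: eq_bigr => i _.
    by rewrite (unsplitK (inl i)).
  by rewrite (unsplitK (inr i)).
Qed.

Lemma sub_pos (R : realType) (n : nat) (S : set 'rV[R]_n) : S `<=` pos S.
Proof.
move=> x Sx; exists 1%N, (fun=> 1), (fun=> x); split=> //.
by rewrite big_ord1 scale1r.
Qed.

Lemma convex_hull_sub_pos (R : realType) (n : nat) (S : set 'rV[R]_n) :
  convex_hull S `<=` pos S.
Proof.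
move=> x; apply; split; last exact: sub_pos.
apply/convex_setE => y z t /andP[t0 t1] Sy Sz.
by apply: pos_add; apply: pos_scale; rewrite ?subr_ge0.
Qed.

(** With base point 0 the weights may have any sum. *)
Lemma profile_set_comb (R : realType) (n : nat) (L M p q : R)
  (u x y : 'rV[R]_n) :
  0 <= p -> 0 <= q -> profile_set L 0 u x -> profile_set M 0 u y ->
  profile_set (p * L + q * M) 0 u (p *: x + q *: y).
Proof.
move=> p0 q0 [f hf ->] [h hh ->].
exists (fun t => p * f t + q * h t); first exact: concave_profile_comb.
by apply/rowP => i; rewrite !mxE !add0r.
Qed.

Lemma profile_setW (R : realType) (n : nat) (L M : R) (b u : 'rV[R]_n) :
  L <= M -> profile_set L b u `<=` profile_set M b u.
Proof.
by move=> LM _ [f hf ->]; exists f => //; apply: concave_profileW hf.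
Qed.

Lemma tconv_pair_sub_profile_set (R : realType) (n : nat) (a b : 'rV[R]_n) :
  tconv [set a; b] `<=` profile_set 1 b (a - b).
Proof.
move=> x; apply; split; first exact: profile_set_tropical.
move=> _ [->|->].
  have := @profile_set_linear R n 1 1 b (a - b).
  by rewrite scale1r subrKC ler01 lexx; apply.
have := @profile_set_linear R n 1 0 b (a - b).
by rewrite scale0r addr0 ler01 lexx; apply.
Qed.

Lemma tconv_tropical (R : realType) (n : nat) (S : set 'rV[R]_n) :
  tropically_convex (tconv S).
Proof.
move=> x y c d Sx Sy cd B [tB sB].
exact: (tB _ _ _ _ (Sx B _) (Sy B _) cd).
Qed.

Lemma sub_tconv (R : realType) (n : nat) (S : set 'rV[R]_n) : S `<=` tconv S.
Proof. by move=> x Sx B [_]; apply. Qed.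

(** * The four sets in terms of profiles *)

Lemma segmentE (R : realType) (n : nat) (a b : 'rV[R]_n) :
  segment a b = [set b + l *: (a - b) | l in [set l : R | 0 <= l <= 1]].
Proof.
have e (l : R) : b + l *: (a - b) = l *: a + (1 - l) *: b.
  by apply/rowP => i; rewrite !mxE; ring.
by apply/seteqP; split=> [x [l [l01 ->]]|x [l l01 <-]]; exists l; rewrite ?e.
Qed.

Lemma tconv_segment (R : realType) (n : nat) (a b : 'rV[R]_n) :
  tconv (segment a b) = profile_set 1 b (a - b).
Proof.
rewrite segmentE; apply/seteqP; split.
  move=> x; apply; split; first exact: profile_set_tropical.
  by move=> _ [l l01 <-]; apply: profile_set_linear.
apply: profile_set_sub_tropical; first exact: tconv_tropical.
by move=> l l01; apply: sub_tconv; exists l.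
Qed.

Lemma convex_hull_tconv_pair (R : realType) (n : nat) (a b : 'rV[R]_n) :
  convex_hull (tconv [set a; b]) = profile_set 1 b (a - b).
Proof.
apply/seteqP; split.
  move=> x; apply; split; first exact: profile_set_convex.
  exact: tconv_pair_sub_profile_set.
by move=> x /profile_set_hull [y hy <-]; rewrite scale1r subrKC.
Qed.

Lemma tconv_ray (R : realType) (n : nat) (a : 'rV[R]_n) :
  tconv (ray a) = \bigcup_(L in [set L : R | 0 <= L]) profile_set L 0 a.
Proof.
apply/seteqP; split.
  move=> x; apply; split.
    move=> y z c d [L /= L0 hy] [M /= M0 hz] cd.
    (* The profile sets grow with the bound, and [L + M] dominates both bounds. *)
    exists (L + M); first exact: addr_ge0.
    by apply: profile_set_tropical => //;
      [apply: profile_setW hy; rewrite lerDl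
      |apply: profile_setW hz; rewrite lerDr].
  move=> _ [l [l0 ->]]; exists l => //.
  by rewrite -[l *: a]add0r; apply: profile_set_linear; rewrite l0 lexx.
move=> x [L _]; apply: profile_set_sub_tropical; first exact: tconv_tropical.
by move=> l /andP[l0 _]; apply: sub_tconv; exists l; rewrite add0r.
Qed.

(** A term [c i *: v i] has slopes at most [c i], and bounds add under sums. Conversely, bound [L]
    means [L] times a point of the convex hull, which lies in the cone. *)
Lemma pos_tconv (R : realType) (n : nat) (a : 'rV[R]_n) :
  pos (tconv [set 0; a]) =
  \bigcup_(L in [set L : R | 0 <= L]) profile_set L 0 a.
Proof.
rewrite setUC; apply/seteqP; split.
  move=> _ [k [c [v [c0 Sv ->]]]].
  have hv i : profile_set 1 0 a (v i).
    by have := tconv_pair_sub_profile_set (Sv i); rewrite subr0.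
  elim/big_ind: _ => [|x y [L /= L0 hx] [M /= M0 hy]|i _].
  - exists 0; rewrite /= ?lexx// -[X in profile_set _ _ _ X]add0r -(scale0r a).
    by apply: profile_set_linear; rewrite lexx.
  - exists (L + M); first exact: addr_ge0.
    by have := profile_set_comb ler01 ler01 hx hy; rewrite !mul1r !scale1r.
  - exists (c i) => //=.
    (* The second summand has weight 0, so this is scaling by [c i]. *)
    have := profile_set_comb (c0 i) (lexx 0) (hv i) (hv i).
    by rewrite mulr1 mul0r scale0r !addr0.
move=> x [L /= L0]; rewrite -{1}[a]subr0 => /profile_set_hull [y hy <-].
rewrite subr0 add0r; apply: pos_scale => //.
exact: convex_hull_sub_pos.
Qed.

Theorem theorem1p4 (R : realType) (n : nat) (a b : 'rV[R]_n) :
  tconv (segment a b) = convex_hull (tconv [set a; b]) /\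
  tconv (ray a) = pos (tconv [set 0; a]).
Proof.
by rewrite tconv_segment convex_hull_tconv_pair tconv_ray pos_tconv.
Qed.
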